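(* Let $\mathcal{G}$ be the strict inductive limit of a sequence $(\mathcal{G}_p)_p$ of metrizable locally convex topological $\widetilde{\mathbb{C}}$-modules. Then the dual $\mathcal{L}(\mathcal{G},\widetilde{\mathbb{C}})$, endowed with the topology $\beta_b(\mathcal{L}(\mathcal{G},\widetilde{\mathbb{C}}),\mathcal{G})$ of uniform convergence on bounded subsets of $\mathcal{G}$, has an absolutely convex and closed web of type $\mathcal{C}$.
   Context: Generalized numbers: $\widetilde{\mathbb{C}}=\mathcal{E}_M/\mathcal{N}$, where $\mathcal{E}_M$ is the ring of nets $(c_\varepsilon)_\varepsilon\in\mathbb{C}^{(0,1]}$ with $|c_\varepsilon|=O(\varepsilon^{-N})$ as $\varepsilon\to0$ for some $N\in\mathbb{N}$, and $\mathcal{N}$ is the ideal of nets with $|c_\varepsilon|=O(\varepsilon^{q})$ for all $q\in\mathbb{N}$; $[(c_\varepsilon)_\varepsilon]$ denotes the class of $(c_\varepsilon)_\varepsilon$. The valuation is $\mathrm{v}(c)=\sup\{b\in\mathbb{R}: |c_\varepsilon|=O(\varepsilon^b)\text{ as }\varepsilon\to0\}$ and $|c|_{\mathrm e}=e^{-\mathrm{v}(c)}$; $\widetilde{\mathbb{C}}$ carries the topology of the ultrametric $|c-d|_{\mathrm e}$. A topological $\widetilde{\mathbb{C}}$-module is a $\widetilde{\mathbb{C}}$-module with a ($\widetilde{\mathbb{C}}$-linear) topology making addition and scalar multiplication $\widetilde{\mathbb{C}}\times\mathcal{G}\to\mathcal{G}$ continuous. A subset $A$ of a $\widetilde{\mathbb{C}}$-module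 is balanced if $\lambda A\subseteq A$ whenever $|\lambda|_{\mathrm e}\le1$; convex if $A+A\subseteq A$ and $[(\varepsilon^b)_\varepsilon]A\subseteq A$ for all $b\ge0$; absolutely convex if balanced and convex. A topological $\widetilde{\mathbb{C}}$-module is locally convex if it has a base of convex neighborhoods of $0$. A set $B$ is bounded if for every neighborhood $U$ of $0$ there is $a\in\mathbb{R}$ with $B\subseteq[(\varepsilon^b)_\varepsilon]U$ for all $b\le a$. Strict inductive limit: $(\mathcal{G}_p)_{p\ge1}$ is an increasing sequence of submodules of the $\widetilde{\mathbb{C}}$-module $\mathcal{G}$ with $\mathcal{G}=\bigcup_p\mathcal{G}_p$; each $\mathcal{G}_p$ carries a locally convex $\widetilde{\mathbb{C}}$-linear topology $\tau_p$ such that $\tau_{p+1}$ induces $\tau_p$ on $\mathcal{G}_p$; and $\mathcal{G}$ carries the finest locally convex $\widetilde{\mathbb{C}}$-linear topology making all inclusions $\mathcal{G}_p\to\mathcal{G}$ continuous. $\mathcal{L}(\mathcal{G},\widetilde{\mathbb{C}})$ is the $\widetilde{\mathbb{C}}$-module of continuous $\widetilde{\mathbb{C}}$-linear functionals on $\mathcal{G}$; $\beta_b(\mathcal{L}(\mathcal{G},\widetilde{\mathbb{C}}),\mathcal{G})$ is the topology given by the family $\mathcal{P}_B(T)=\sup_{u\in B}|Tu|_{\mathrm e}$, $B$ ranging over the bounded subsets of $\mathcal{G}$. A web on a locally convex topological $\widetilde{\mathbb{C}}$-module $\mathcal{F}$ is a family $\mathcal{W}=\{C(n_1,\dots,n_k)\}$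 of subsets of $\mathcal{F}$, with $k,n_1,\dots,n_k$ running through $\mathbb{N}\setminus0$, such that $\mathcal{F}=\bigcup_{n_1\ge1}C(n_1)$ and $C(n_1,\dots,n_{k-1})=\bigcup_{n_k\ge1}C(n_1,\dots,n_k)$ for all $k>1$ and all $n_1,\dots,n_{k-1}$. The web is absolutely convex (resp. closed) if all its sets are. It is of type $\mathcal{C}$ if for every sequence $(n_k)_{k\ge1}$ in $\mathbb{N}\setminus0$ there is a sequence $(\rho_k)_{k\ge1}$ in $\mathbb{R}$ such that for all $\lambda_k\ge\rho_k$ and all $x_k\in C(n_1,\dots,n_k)$ ($k\ge1$) the series $\sum_{k=1}^\infty[(\varepsilon^{\lambda_k})_\varepsilon]x_k$ converges in $\mathcal{F}$. *)

(* Defs.v *)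
From HB Require Import structures.
From mathcomp Require Import all_boot all_order all_algebra.
From mathcomp Require Import generic_quotient ring_quotient.
From mathcomp Require Import complex lra.
From mathcomp Require Import all_classical all_reals all_analysis.

Set Implicit Arguments.
Unset Strict Implicit.
Unset Printing Implicit Defensive.

Import Order.TTheory GRing.Theory Num.Theory.
Import numFieldNormedType.Exports.
Import ComplexField.Normc.

Local Open Scope classical_set_scope.
Local Open Scope ring_scope.
Local Open Scope quotient_scope.

Section Nets.
Context (R : realType).

Definition eps_index := {e : R | 0 < e <= 1}.

Lemma one_in_eps_index : 0 < (1 : R) <= 1.
Proof. by rewrite ltr01 lexx. Qed.

HB.instance Definition _ := Choice.on eps_index.
HB.instance Definition _ :=
  isPointed.Build eps_index (exist _ (1 : R) one_in_eps_index).

Definition net := eps_index -> R[i].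

HB.instance Definition _ := GRing.ComNzRing.on net.

Definition bigO_eps (u : net) (b : R) : Prop :=
  exists K eta : R, 0 < eta /\
    forall e : eps_index, val e < eta -> normc (u e) <= K * (val e `^ b).

Lemma eps_gt0 (e : eps_index) : 0 < val e.
Proof. by case: e => e /= /andP[]. Qed.

Lemma eps_le1 (e : eps_index) : val e <= 1.
Proof. by case: e => e /= /andP[]. Qed.

Lemma normc_ge0 (z : R[i]) : 0 <= normc z.
Proof. by case: z => a b; rewrite /normc sqrtr_ge0. Qed.

Lemma normcD (x y : R[i]) : normc (x + y) <= normc x + normc y.
Proof.
have := ler_normD x y.
by case: x y => a b [c d]; rewrite {1}/Num.norm /= lecE /= addr0 eqxx.
Qed.

Lemma bigO_eps_le (u : net) (b b' : R) :
  b' <= b -> bigO_eps u b -> bigO_eps u b'.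
Proof.
move=> bb' [K [eta [eta0 H]]].
exists `|K|, eta; split=> // e /H /le_trans; apply.
apply: (@le_trans _ _ (`|K| * val e `^ b)).
  by rewrite ler_wpM2r ?powR_ge0 ?ler_norm.
apply: ler_wpM2l => //; apply: ger_powR => //.
by rewrite eps_gt0 eps_le1.
Qed.

Lemma bigO_eps0 (b : R) : bigO_eps 0 b.
Proof. by exists 0, 1; split=> // e _; rewrite mul0r normc0. Qed.

Lemma bigO_epsN (u : net) (b : R) : bigO_eps u b -> bigO_eps (- u) b.
Proof.
move=> [K [eta [eta0 H]]]; exists K, eta; split=> // e /H.
by rewrite opprfctE; case: (u e) => x y /=; rewrite !sqrrN.
Qed.

Lemma bigO_epsD (u w : net) (b : R) :
  bigO_eps u b -> bigO_eps w b -> bigO_eps (u + w) b.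
Proof.
move=> [K [eta [eta0 H]]] [K' [eta' [eta'0 H']]].
exists (K + K'), (Num.min eta eta'); split; first by rewrite lt_min eta0.
move=> e; rewrite lt_min => /andP[/H h /H' h'].
by rewrite mulrDl; apply: le_trans (lerD h h'); exact: normcD.
Qed.

Lemma bigO_epsM (u w : net) (a b : R) :
  bigO_eps u a -> bigO_eps w b -> bigO_eps (u * w) (a + b).
Proof.
move=> [K [eta [eta0 H]]] [K' [eta' [eta'0 H']]].
exists (K * K'), (Num.min eta eta'); split; first by rewrite lt_min eta0.
move=> e; rewrite lt_min => /andP[/H h /H' h'].
rewrite powRD; last by rewrite (gt_eqF (eps_gt0 e)) implybT.
by rewrite mulrACA mulrfctE normcM ler_pM ?normc_ge0.
Qed.

Definition moderate : {pred net} :=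
  fun u : net => `[< exists N : nat, bigO_eps u (- N%:R) >].

Lemma moderateP u :
  reflect (exists N : nat, bigO_eps u (- N%:R)) (u \in moderate).
Proof. exact: asboolP. Qed.

Lemma bigO_eps_expeps (b : R) :
  bigO_eps (fun e : eps_index => (val e `^ b)%:C%C) b.
Proof.
exists 1, 1; split=> // e _.
by rewrite /= expr0n addr0 sqrtr_sqr mul1r ger0_norm ?powR_ge0.
Qed.

Lemma bigO_moderate u b : bigO_eps u b -> u \in moderate.
Proof.
move=> Ou; apply/moderateP; exists (Num.bound `|b|).
apply: bigO_eps_le Ou; rewrite lerNl.
apply: (le_trans (ler_norm _)); rewrite normrN.
exact/ltW/archi_boundP/normr_ge0.
Qed.

Lemma bigO_eps1 : bigO_eps 1 0.
Proof. by exists 1, 1; split=> // e _; rewrite powRr0 mulr1 normc1. Qed.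

Lemma moderate_subring : subring_closed moderate.
Proof.
split.
- exact: bigO_moderate bigO_eps1.
- move=> u w /moderateP[N Ou] /moderateP[M Ow]; apply/moderateP.
  exists (maxn N M); apply: bigO_epsD; last apply: bigO_epsN.
    by apply: bigO_eps_le Ou; rewrite lerN2 ler_nat leq_maxl.
  by apply: bigO_eps_le Ow; rewrite lerN2 ler_nat leq_maxr.
- move=> u w /moderateP[N Ou] /moderateP[M Ow].
  exact: bigO_moderate (bigO_epsM Ou Ow).
Qed.

HB.instance Definition _ :=
  GRing.isSubringClosed.Build net moderate moderate_subring.

Definition EM := {u : net | u \in moderate}.

HB.instance Definition _ := SubChoice.on EM.
HB.instance Definition _ := [SubChoice_isSubComNzRing of EM by <:].

Definition negligible : {pred EM} :=
  fun u : EM => `[< forall q : nat, bigO_eps (val u) q%:R >].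

Lemma negligibleP u :
  reflect (forall q : nat, bigO_eps (val u) q%:R) (u \in negligible).
Proof. exact: asboolP. Qed.

Lemma negligible_bigO u b : u \in negligible -> bigO_eps (val u) b.
Proof.
move=> /negligibleP /(_ (Num.bound `|b|)); apply: bigO_eps_le.
apply: (le_trans (ler_norm _)).
exact/ltW/archi_boundP/normr_ge0.
Qed.

Lemma negligible_ideal : idealr_closed negligible.
Proof.
split.
- by apply/negligibleP => q; rewrite rmorph0; exact: bigO_eps0.
- apply/negligibleP => /(_ 1%N)[K [eta [eta0]]].
  rewrite rmorph1 => H.
  pose e0 := Num.min (eta / 2) (Num.min 1 (`|K| + 1)^-1 / 2).
  have K1 : 0 < `|K| + 1 by rewrite ltr_wpDl.
  have h0 : 0 < e0 <= 1.
    rewrite /e0 lt_min !divr_gt0 ?lt_min ?invr_gt0 ?ltr01 ?K1//=.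
    rewrite ge_min; apply/orP; right.
    by rewrite ler_pdivrMr// mul1r ge_min ler1n.
  have e00 : 0 <= e0 by apply: ltW; case/andP: (h0).
  pose e : eps_index := exist _ e0 h0.
  have /H : val e < eta.
    by rewrite /= gt_min ltr_pdivrMr// ltr_pMr// ltr1n.
  rewrite normc1 powRr1 ?(ltW (eps_gt0 e))//= leNgt => /negP; apply.
  apply: (@le_lt_trans _ _ (`|K| * (`|K| + 1)^-1)).
    apply: (@le_trans _ _ (`|K| * e0)).
      by rewrite ler_wpM2r ?ler_norm.
    rewrite ler_wpM2l// /e0 ge_min; apply/orP; right.
    rewrite ler_pdivrMr// ge_min; apply/orP; right.
    by rewrite ler_peMr ?ler1n// invr_ge0 ltW.
  by rewrite ltr_pdivrMr// mul1r ltrDl.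
- move=> a u w /negligibleP Ou /negligibleP Ow; apply/negligibleP => q.
  rewrite rmorphD rmorphM; apply: bigO_epsD => //.
  have /moderateP[N Oa] := valP a.
  have := bigO_epsM Oa (Ou (N + q)%N); apply: bigO_eps_le.
  by rewrite natrD addKr.
Qed.

HB.instance Definition _ := isIdealr.Build EM negligible negligible_ideal.

Definition Ctilde := {ideal_quot negligible}.

HB.instance Definition _ := Choice.on Ctilde.
HB.instance Definition _ := GRing.ComNzRing.on Ctilde.
HB.instance Definition _ := EqQuotient.on Ctilde.

(* The class [(eps^b)_eps]. *)
Definition eps_pow (b : R) : Ctilde :=
  \pi_Ctilde (exist _ (fun e : eps_index => (val e `^ b)%:C%C)
    (bigO_moderate (bigO_eps_expeps b)) : EM).


Definition valuation (c : Ctilde) : \bar R :=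
  ereal_sup [set b%:E | b in bigO_eps (val (repr c))].

Definition enorm (c : Ctilde) : R := fine (expeR (- valuation c)).

(* The set of exponents does not depend on the chosen representative. *)
Lemma bigO_eps_repr (u : EM) :
  bigO_eps (val (repr (\pi_Ctilde u))) = bigO_eps (val u).
Proof.
have H : repr (\pi_Ctilde u) - u \in negligible.
  by rewrite Quotient.idealrBE reprK.
apply/funext => b; apply/propext; split=> O.
- rewrite -[u](subKr (repr (\pi_Ctilde u))) rmorphB.
  by apply: bigO_epsD => //; apply: bigO_epsN; exact: negligible_bigO.
- rewrite -[repr _](subrK u) rmorphD.
  by apply: bigO_epsD => //; exact: negligible_bigO.
Qed.

Lemma valuation_pi (u : EM) :
  valuation (\pi_Ctilde u) = ereal_sup [set b%:E | b in bigO_eps (val u)].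
Proof. by rewrite /valuation bigO_eps_repr. Qed.

Lemma valuationNy (c : Ctilde) : (-oo < valuation c)%E.
Proof.
have /moderateP[N ON] := valP (repr c).
apply: (@lt_le_trans _ _ (- N%:R)%:E); first by rewrite ltNyr.
by apply: ereal_sup_ubound; exists (- N%:R).
Qed.

Lemma enorm_ge0 (c : Ctilde) : 0 <= enorm c.
Proof. by rewrite fine_ge0 ?expeR_ge0. Qed.

Lemma enormE (c : Ctilde) : (enorm c)%:E = expeR (- valuation c).
Proof.
rewrite fineK//; move: (valuationNy c).
by case: (valuation c).
Qed.

Lemma enorm_leP (c : Ctilde) (r : R) : 0 < r ->
  enorm c <= r <-> forall b, b < - ln r -> bigO_eps (val (repr c)) b.
Proof.
move=> r0; rewrite -lee_fin enormE -[in r%:E](lnK r0).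
rewrite -[(expR (ln r))%:E]/(expeR (ln r)%:E) lee_expeR leeNl -EFinN.
split=> [h b bv|h].
- have : (b%:E < valuation c)%E by apply: lt_le_trans h; rewrite lte_fin.
  move=> /ereal_sup_gt[_ [b' Ob' <-]]; rewrite lte_fin => /ltW bb'.
  exact: bigO_eps_le Ob'.
- rewrite leNgt; apply/negP => hlt.
  have [v vE] : exists v, valuation c = v%:E.
    move: (valuationNy c) hlt; case: (valuation c) => [v| |]//=.
    by exists v.
  move: hlt; rewrite vE lte_fin => hlt.
  have /h Ob : (v - ln r) / 2 < - ln r.
    by rewrite ltr_pdivrMr// mulr_natr mulr2n ltrD2r.
  have : (((v - ln r) / 2)%:E <= valuation c)%E.
    by apply: ereal_sup_ubound; exists ((v - ln r) / 2).
  rewrite vE lee_fin ler_pdivrMr// mulr_natr mulr2n lerD2l leNgt.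
  by rewrite hlt.
Qed.

Lemma bigO_reprD (c d : Ctilde) b : bigO_eps (val (repr c)) b ->
  bigO_eps (val (repr d)) b -> bigO_eps (val (repr (c + d))) b.
Proof.
move=> Oc Od; rewrite -[c]reprK -[d]reprK -[_ + _]pi_addr bigO_eps_repr rmorphD.
exact: bigO_epsD.
Qed.

Lemma bigO_reprM (c d : Ctilde) a b : bigO_eps (val (repr c)) a ->
  bigO_eps (val (repr d)) b -> bigO_eps (val (repr (c * d))) (a + b).
Proof.
move=> Oc Od; rewrite -[c]reprK -[d]reprK -[_ * _]pi_mulr bigO_eps_repr rmorphM.
exact: bigO_epsM.
Qed.

Lemma bigO_reprN (c : Ctilde) b : bigO_eps (val (repr c)) b ->
  bigO_eps (val (repr (- c))) b.
Proof.
move=> Oc; rewrite -[c]reprK -[- _]pi_oppr bigO_eps_repr rmorphN.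
exact: bigO_epsN.
Qed.

Lemma enormN (c : Ctilde) : enorm (- c) = enorm c.
Proof.
rewrite /enorm /valuation; congr (fine (expeR (- ereal_sup (image _ _)))).
apply/funext => b; apply/propext; split; last exact: bigO_reprN.
by move/bigO_reprN; rewrite opprK.
Qed.

Lemma enorm_ultra (c d : Ctilde) (r : R) : 0 < r ->
  enorm c <= r -> enorm d <= r -> enorm (c + d) <= r.
Proof.
move=> r0 /(enorm_leP _ r0) hc /(enorm_leP _ r0) hd.
by apply/(enorm_leP _ r0) => b br; apply: bigO_reprD; [exact: hc|exact: hd].
Qed.

Lemma enorm_mul (c d : Ctilde) (r s : R) : 0 < r -> 0 < s ->
  enorm c <= r -> enorm d <= s -> enorm (c * d) <= r * s.
Proof.
move=> r0 s0 /(enorm_leP _ r0) hc /(enorm_leP _ s0) hd.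
apply/(enorm_leP _ (mulr_gt0 r0 s0)) => b; rewrite lnM ?posrE// => br.
pose t := (- (ln r + ln s) - b) / 2.
have t0 : 0 < t by rewrite divr_gt0 ?subr_gt0.
have -> : b = (- ln r - t) + (- ln s - t).
  by rewrite /t; lra.
by apply: bigO_reprM; [apply: hc|apply: hd]; rewrite ltrBlDr ltrDl.
Qed.

Lemma enorm_eq0 (c : Ctilde) : enorm c = 0 <-> c = 0.
Proof.
have H : (forall r, 0 < r -> enorm c <= r) <-> forall b, bigO_eps (val (repr c)) b.
  split=> [h b|h r r0]; last by apply/(enorm_leP _ r0).
  have /(enorm_leP _ (expR_gt0 _)) := h (expR (- (b + 1))) (expR_gt0 _).
  by apply; rewrite expRK opprK ltrDl.
split=> [c0|->].
- have /H Oc : forall r, 0 < r -> enorm c <= r by move=> r /ltW; rewrite c0.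
  rewrite -[c]reprK -[RHS]pi_zeror; apply/eqP.
  by rewrite -Quotient.idealrBE subr0; apply/negligibleP => q; exact: Oc.
- apply/eqP; rewrite eq_le enorm_ge0 andbT.
  apply/ler_addgt0Pr => r r0; rewrite add0r; apply/(enorm_leP _ r0) => b _.
  by rewrite -[0]pi_zeror bigO_eps_repr rmorph0; exact: bigO_eps0.
Qed.

Lemma enorm_max (c d : Ctilde) : enorm (c + d) <= Num.max (enorm c) (enorm d).
Proof.
apply/ler_addgt0Pr => e e0; apply: enorm_ultra.
- by rewrite ltr_wpDl// le_max enorm_ge0.
- by rewrite ler_wpDr ?(ltW e0)// le_max lexx.
- by rewrite ler_wpDr ?(ltW e0)// le_max lexx orbT.
Qed.

Definition edist (c d : Ctilde) : R := enorm (c - d).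

Lemma edistxx c : edist c c = 0.
Proof. by rewrite /edist subrr; apply/enorm_eq0. Qed.

Lemma edist_eq0 c d : edist c d = 0 -> c = d.
Proof. by move/enorm_eq0/eqP; rewrite subr_eq0 => /eqP. Qed.

Lemma edistC c d : edist c d = edist d c.
Proof. by rewrite /edist -enormN opprB. Qed.

Lemma edist_triangle d c f : edist c f <= edist c d + edist d f.
Proof.
rewrite /edist -(subrKA d c (-f)); apply: le_trans (enorm_max _ _) _.
by rewrite ge_max lerDl lerDr !enorm_ge0.
Qed.

HB.instance Definition _ :=
  isMetric.Build R Ctilde edistxx edist_eq0 edistC edist_triangle.

End Nets.

Section Topologies.

Record topology (T : Type) := Topology {
  opens : set (set T);
  opens_setT : opens setT;
  opens_setI : setI_closed opens;
  opens_bigcup : forall (I : Type) (f : I -> set T),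
    (forall i, opens (f i)) -> opens (\bigcup_i f i) }.

(* A copy of T, on which the library's open, closed, nbhs, continuous and -->
   refer to the topology t. *)
Definition topologized (T : Type) (t : topology T) : Type := T.

HB.instance Definition _ (T : choiceType) (t : topology T) :=
  Choice.copy (topologized t) T.

HB.instance Definition _ (T : choiceType) (t : topology T) :=
  isOpenTopological.Build (topologized t)
    (@opens_setT T t) (@opens_setI T t) (@opens_bigcup T t).

HB.instance Definition _ (K : pzRingType) (V : lmodType K) (t : topology V) :=
  GRing.Lmodule.copy (topologized t) V.

End Topologies.

Section Submodules.
Context (K : pzRingType) (V : lmodType K).

Definition submod_of (S : submodClosed V) : Type := {x : V | x \in S}.

HB.instance Definition _ (S : submodClosed V) := SubChoice.on (submod_of S).

Lemma submod_of_closed (S : submodClosed V) :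
  subsemimod_closed (fun x => x \in S).
Proof. by split; [exact: rpred0D|move=> a x; exact: rpredZ]. Qed.

HB.instance Definition _ (S : submodClosed V) :=
  GRing.SubChoice_isSubLmodule.Build K V (fun x => x \in S) (submod_of S)
    (submod_of_closed S).

End Submodules.

Section TopologicalModules.
Context (R : realType).
Implicit Types (V : lmodType (Ctilde R)).

Definition linear_topology V (t : topology V) : Prop :=
  continuous (fun z : topologized t * topologized t =>
    (z.1 + z.2 : topologized t)) /\
  continuous (fun z : Ctilde R * topologized t =>
    (z.1 *: z.2 : topologized t)).

Definition balanced V (A : set V) : Prop :=
  forall (l : Ctilde R) x, enorm l <= 1 -> A x -> A (l *: x).

Definition convex V (A : set V) : Prop :=
  (forall x y, A x -> A y -> A (x + y)) /\
  (forall (b : R) x, 0 <= b -> A x -> A (eps_pow b *: x)).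

Definition absolutely_convex V (A : set V) : Prop := balanced A /\ convex A.

Definition locally_convex V (t : topology V) : Prop :=
  linear_topology t /\
  forall U, nbhs (0 : topologized t) U ->
    exists2 A : set V, nbhs (0 : topologized t) A & convex A /\ A `<=` U.

Definition bounded V (t : topology V) (B : set V) : Prop :=
  forall U, nbhs (0 : topologized t) U ->
    exists a : R, forall b, b <= a -> B `<=` [set eps_pow b *: u | u in U].

Definition metrizable (T : choiceType) (t : topology T) : Prop :=
  exists d : T -> T -> R,
    [/\ forall x y, 0 <= d x y,
        forall x y, d x y = 0 <-> x = y,
        forall x y, d x y = d y x,
        forall x y z, d x z <= d x y + d y z &
        forall (x : topologized t) A, nbhs x A <->
          exists2 r, 0 < r & [set y | d x y < r] `<=` A].

Section StrictInductiveLimit.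
Variables (G : lmodType (Ctilde R)) (Gs : nat -> submodClosed G).
Variables (ts : forall p, topology (submod_of (Gs p))).

Definition continuous_inclusions (t : topology G) : Prop :=
  forall p, continuous (fun x : topologized (ts p) => (val x : topologized t)).

(* tau_(p+1) induces tau_p; the sets are compared inside G *)
Definition induces_next (p : nat) : Prop :=
  forall A : set (submod_of (Gs p)), opens (ts p) A <->
    exists2 B, opens (ts p.+1) B &
      [set val x | x in A] = [set val y | y in B] `&` [set x | x \in Gs p].

Record strict_inductive_limit (t : topology G) : Prop := StrictInductiveLimit {
  sil_increasing : forall p, {subset Gs p <= Gs p.+1};
  sil_exhausting : forall u, exists p, u \in Gs p;
  sil_locally_convex_steps : forall p, locally_convex (ts p);
  sil_induces : forall p, induces_next p;
  sil_locally_convex : locally_convex t;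
  sil_continuous : continuous_inclusions t;
  sil_finest : forall t' : topology G,
    locally_convex t' -> continuous_inclusions t' -> opens t' `<=` opens t }.

End StrictInductiveLimit.

Lemma enorm_cvgP (T : topologicalType) (f : T -> Ctilde R) (x : T) :
  {for x, continuous f} <->
  forall r, 0 < r -> \forall y \near x, enorm (f y - f x) < r.
Proof.
split.
- move=> h r r0; have H : nbhs (f x) (ball (f x) r) by exact: nbhsx_ballx.
  have := h _ H; rewrite nbhs_simpl => h'; near=> y.
  have : ball (f x) r (f y) by near: y.
  by rewrite ballEmdist /= -[mdist _ _]/(edist _ _) edistC.
- move=> h A /nbhs_ballP[r r0 rA]; apply: filterS (h r r0) => y yr.
  by apply: rA; rewrite ballEmdist /= -[mdist _ _]/(edist _ _) edistC.
Unshelve. all: by end_near. Qed.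

(* The topology with neighbourhood bases given by the finite intersections of
   balls of the P i, i in D. *)
Section SeminormTopology.
Variables (V : lmodType (Ctilde R)) (I : choiceType) (D : set I).
Variable (P : I -> V -> \bar R).

Definition seminorm_opens : set (set V) :=
  [set O | forall x, O x -> exists (F : set I) (r : R),
     [/\ finite_set F, F `<=` D, 0 < r &
         [set y | forall i, F i -> (P i (y - x) < r%:E)%E] `<=` O]].

Lemma seminorm_opens_setT : seminorm_opens setT.
Proof. by move=> x _; exists set0, 1; split. Qed.

Lemma seminorm_opens_setI : setI_closed seminorm_opens.
Proof.
move=> A B oA oB x [/oA[F [r [Ff FD r0 FA]]] /oB[F' [r' [F'f F'D r'0 FB]]]].
exists (F `|` F'), (Num.min r r'); split.
- by rewrite finite_setU.
- by move=> i [/FD|/F'D].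
- by rewrite lt_min r0.
- move=> y h; split; [apply: FA => i Fi|apply: FB => i Fi].
  + have := h i (or_introl Fi); move=> /lt_le_trans; apply.
    by rewrite lee_fin ge_min lexx.
  + have := h i (or_intror Fi); move=> /lt_le_trans; apply.
    by rewrite lee_fin ge_min lexx orbT.
Qed.

Lemma seminorm_opens_bigcup (J : Type) (f : J -> set V) :
  (forall j, seminorm_opens (f j)) -> seminorm_opens (\bigcup_j f j).
Proof.
move=> h x [j _ /h[F [r [Ff FD r0 Fj]]]]; exists F, r; split=> //.
by move=> y /Fj; exists j.
Qed.

Definition seminorm_topology : topology V :=
  Topology seminorm_opens_setT seminorm_opens_setI seminorm_opens_bigcup.


Hypothesis PD : forall i x y (r : R), 0 < r ->
  (P i x <= r%:E)%E -> (P i y <= r%:E)%E -> (P i (x + y)%R <= r%:E)%E.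
Hypothesis PZ : forall i a x (r s : R), 0 < r -> 0 < s ->
  enorm a <= r -> (P i x <= s%:E)%E -> (P i (a *: x)%R <= (r * s)%:E)%E.
Hypothesis Pfin : forall i x, D i -> exists2 s : R, 0 < s & (P i x <= s%:E)%E.

Lemma seminorm0 i r : D i -> 0 < r -> (P i 0 <= r%:E)%E.
Proof.
move=> Di r0; have [s s0 H] := Pfin 0 Di.
have n0 : enorm (0 : Ctilde R) <= r / s.
  by have /enorm_eq0 -> : (0 : Ctilde R) = 0 by []; rewrite ltW// divr_gt0.
have := PZ (divr_gt0 r0 s0) s0 n0 H.
by rewrite scale0r divfK// gt_eqF.
Qed.

Lemma nbhs_seminormP (x : topologized seminorm_topology) (A : set V) :
  nbhs x A <-> exists (F : set I) (r : R),
    [/\ finite_set F, F `<=` D, 0 < r &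
        [set y | forall i, F i -> (P i (y - x) <= r%:E)%E] `<=` A].
Proof.
rewrite nbhsE; split.
- move=> [W [oW /oW[F [r [Ff FD r0 FW]]]] WA].
  exists F, (r / 2); split=> //; first by rewrite divr_gt0.
  move=> y h; apply: WA; apply: FW => i /h /le_lt_trans; apply.
  by rewrite lte_fin ltr_pdivrMr// ltr_pMr// ltr1n.
- move=> [F [r [Ff FD r0 FA]]].
  exists [set y | forall i, F i -> (P i (y - x) <= r%:E)%E] => //; split.
  + move=> y hy; exists F, r; split=> // z h i Fi.
    by rewrite -(subrKA y); apply: PD => //; [apply/ltW/h|exact: hy].
  + by move=> i /FD Di; rewrite subrr; exact: seminorm0.
Qed.

Lemma near_seminorm (x : topologized seminorm_topology) i r : D i -> 0 < r ->
  \forall y \near x, (P i (y - x) <= r%:E)%E.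
Proof.
move=> Di r0; apply/nbhs_seminormP; exists [set i], r; split=> //.
- by move=> _ ->.
- by move=> y /= /(_ i); apply.
Qed.

Lemma seminorm_cvgP (T : topologicalType) (f : T -> V) (x : T) :
  (forall i (r : R), D i -> 0 < r ->
    \forall y \near x, (P i (f y - f x) <= r%:E)%E) ->
  {for x, continuous (f : T -> topologized seminorm_topology)}.
Proof.
move=> h A /nbhs_seminormP[F [r [Ff FD r0 FA]]].
have : nbhs x (\bigcap_(i in F) [set y | (P i (f y - f x) <= r%:E)%E]).
  case/finite_fsetP: Ff FD FA => F' -> FD _.
  by apply: filter_bigI => i Fi; apply: h => //; exact: FD.
by apply: filterS => y hy; apply: FA.
Qed.

Lemma enorm_eps_pow (b : R) : enorm (eps_pow b) <= expR (- b).
Proof.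
apply/(enorm_leP _ (expR_gt0 _)) => b'; rewrite expRK opprK => /ltW b'b.
by rewrite bigO_eps_repr; exact: bigO_eps_le (bigO_eps_expeps b).
Qed.

Lemma seminorm_topology_locally_convex : locally_convex seminorm_topology.
Proof.
split; first split.
- move=> [x y]; apply: seminorm_cvgP => i r Di r0 /=.
  near=> z; rewrite opprD addrACA; apply: PD => //.
  + near: z; apply: (cvg_fst (near_seminorm x Di r0)).
  + near: z; apply: (cvg_snd (near_seminorm y Di r0)).
- move=> [a x]; apply: seminorm_cvgP => i r Di r0 /=.
  have [s s0 xs] := Pfin x Di.
  pose m := Num.max (enorm a) 1.
  have m0 : 0 < m by rewrite lt_max ltr01 orbT.
  have d0 : 0 < Num.min 1 (r / s) by rewrite lt_min ltr01 divr_gt0.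
  near=> z.
  have za : enorm (z.1 - a) < Num.min 1 (r / s).
    near: z; apply: (@cvg_fst _ _ (nbhs a) (nbhs x) _
      [set b | enorm (b - a) < Num.min 1 (r / s)]).
    by have /(enorm_cvgP id a)/(_ _ d0) : {for a, continuous (@id (Ctilde R))}
      by [].
  have zx : (P i (z.2 - x)%R <= (r / m)%:E)%E.
    near: z; apply: (cvg_snd (near_seminorm x Di (divr_gt0 r0 m0))).
  move: za; rewrite lt_min => /andP[za1 zars].
  have -> : z.1 *: z.2 - a *: x = z.1 *: (z.2 - x) + (z.1 - a) *: x.
    by rewrite scalerBr scalerBl addrA subrK.
  apply: PD => //.
  + have zm : enorm z.1 <= m.
      rewrite -(subrK a z.1); apply: le_trans (enorm_max _ _) _.
      by rewrite ge_max /m !le_max lexx (ltW za1) orbT.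
    have := PZ m0 (divr_gt0 r0 m0) zm zx.
    by rewrite mulrC divfK// gt_eqF.
  + have := PZ (divr_gt0 r0 s0) s0 (ltW zars) xs.
    by rewrite divfK// gt_eqF.
- move=> U /nbhs_seminormP[F [r [Ff FD r0 FU]]].
  exists [set y | forall i, F i -> (P i (y - 0) <= r%:E)%E].
    by apply/nbhs_seminormP; exists F, r; split.
  split=> //; split=> [x y hx hy i Fi|b x b0 hx i Fi].
    by rewrite subr0; apply: PD => //; [have := hx i Fi|have := hy i Fi];
      rewrite subr0.
  have := PZ (i := i) (a := eps_pow b) (x := x) ltr01 r0.
  rewrite mul1r subr0; apply; last by have := hx i Fi; rewrite subr0.
  by apply: le_trans (enorm_eps_pow b) _; rewrite -expR0 ler_expR oppr_le0.
Unshelve. all: by end_near. Qed.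

End SeminormTopology.

Section Dual.
Variables (G : lmodType (Ctilde R)) (t : topology G).

Definition dual_pred : {pred G -> (Ctilde R)^o} :=
  fun f : G -> (Ctilde R)^o => `[< linear f /\ continuous (f : topologized t -> Ctilde R) >].

Lemma dual_predP (f : G -> (Ctilde R)^o) :
  reflect (linear f /\ continuous (f : topologized t -> Ctilde R))
          (f \in dual_pred).
Proof. exact: asboolP. Qed.

Lemma dual_pred_closed : subsemimod_closed dual_pred.
Proof.
split; first split.
- apply/dual_predP; split; first by move=> a x y; rewrite scaler0 addr0.
  exact: cst_continuous.
- move=> f g /dual_predP[lf cf] /dual_predP[lg cg]; apply/dual_predP; split.
    by move=> a x y; rewrite !fctE lf lg scalerDr addrACA.
  move=> x; apply/enorm_cvgP => r r0.
  have /enorm_cvgP/(_ _ r0) hf := cf x; have /enorm_cvgP/(_ _ r0) hg := cg x.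
  apply: filterS2 hf hg => y fy gy; rewrite !fctE opprD addrACA.
  by apply: le_lt_trans (enorm_max _ _) _; rewrite gt_max fy.
- move=> a f /dual_predP[lf cf]; apply/dual_predP; split.
    by move=> b x y; rewrite !fctE lf scalerDr !scalerA mulrC.
  move=> x; apply/enorm_cvgP => r r0.
  have n0 : 0 < enorm a + 1 by rewrite ltr_wpDl ?enorm_ge0.
  have s0 : 0 < r / 2 / (enorm a + 1) by rewrite !divr_gt0.
  have /enorm_cvgP/(_ _ s0) hf := cf x.
  apply: filterS hf => y /ltW fy; rewrite !fctE.
  rewrite -[_ - _]/(a * f y - a * f x) -mulrBr.
  have := enorm_mul n0 s0 _ fy => /(_ a); rewrite lerDl ler01 => /(_ isT).
  move=> /le_lt_trans; apply.
  rewrite mulrC divfK ?gt_eqF// ltr_pdivrMr// mulr_natr mulr2n.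
  by rewrite ltrDl.
Qed.

HB.instance Definition _ :=
  GRing.isSubmodClosed.Build (Ctilde R) (G -> (Ctilde R)^o) dual_pred
    dual_pred_closed.

Definition dual : lmodType (Ctilde R) := submod_of dual_pred.

(* extended-real valued, so that no boundedness of T on B is presupposed *)
Definition sup_seminorm (B : set G) (T : dual) : \bar R :=
  ereal_sup [set (enorm (val T u))%:E | u in B].

Definition strong_topology : topology dual :=
  seminorm_topology (bounded t) sup_seminorm.

Lemma sup_seminormP B T r :
  (sup_seminorm B T <= r%:E)%E <-> forall u, B u -> enorm (val T u) <= r.
Proof.
split=> [h u Bu|h].
- rewrite -lee_fin; apply: le_trans h.
  by apply: ereal_sup_ubound; exists u.
- by apply: ge_ereal_sup => _ [u Bu <-]; rewrite lee_fin; exact: h.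
Qed.

Lemma sup_seminorm_fin B T : bounded t B ->
  exists2 s, 0 < s & (sup_seminorm B T <= s%:E)%E.
Proof.
have /dual_predP[lT cT] := valP T.
have T0 : val T 0 = 0 by have := lT (-1) 0 0; rewrite scaleN1r oppr0 addr0
  scaleN1r addNr.
have /enorm_cvgP/(_ 1 ltr01) := cT 0; rewrite T0 => U0 /(_ _ U0)[a Ba].
exists (expR (- a)); first exact: expR_gt0.
apply/sup_seminormP => u /(Ba a (lexx a))[v /ltW v1 <-].
have -> : val T (eps_pow a *: v) = eps_pow a * (val T v - 0).
  by rewrite -[_ *: v]addr0 lT T0 addr0 subr0.
rewrite -[expR _]mulr1; apply: enorm_mul; rewrite ?expR_gt0//.
exact: enorm_eps_pow.
Qed.

Lemma dual_addE (S T : dual) u : val (S + T) u = val S u + val T u.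
Proof. by rewrite raddfD. Qed.

Lemma dual_scaleE a (T : dual) u :
  val (a *: T) u = (a * (val T u : Ctilde R) : Ctilde R).
Proof. by rewrite linearZ. Qed.

Lemma strong_topology_locally_convex : locally_convex strong_topology.
Proof.
apply: seminorm_topology_locally_convex.
- move=> B S T r r0 /sup_seminormP hS /sup_seminormP hT.
  apply/sup_seminormP => u Bu; rewrite dual_addE.
  by apply: enorm_ultra r0 _ _; [exact: hS|exact: hT].
- move=> B a T r s r0 s0 ar /sup_seminormP hT.
  apply/sup_seminormP => u Bu; rewrite dual_scaleE.
  by apply: enorm_mul r0 s0 ar _; exact: hT.
- move=> B T; exact: sup_seminorm_fin.
Qed.

End Dual.

Section Webs.
Variables (F : lmodType (Ctilde R)) (t : topology F).

(* N\0 is used only as an index set; it is replaced by nat, the set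
   C(n_1, ..., n_k), k >= 1, being W [:: n_1; ...; n_k]. The value W [::] is
   irrelevant. *)
Definition is_web (W : seq nat -> set F) : Prop :=
  [set: F] = \bigcup_n W [:: n] /\
  forall s, s != [::] -> W s = \bigcup_n W (rcons s n).

Definition absolutely_convex_web (W : seq nat -> set F) : Prop :=
  forall s, s != [::] -> absolutely_convex (W s).

Definition closed_web (W : seq nat -> set F) : Prop :=
  forall s, s != [::] -> closed (W s : set (topologized t)).

Definition web_of_type_C (W : seq nat -> set F) : Prop :=
  forall n : nat -> nat, exists rho : nat -> R,
  forall (l : nat -> R) (x : nat -> F),
    (forall k, rho k <= l k) -> (forall k, W (mkseq n k.+1) (x k)) ->
    exists y : topologized t,
      (series (fun k => eps_pow (l k) *: x k) : nat -> topologized t) @ \oo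
        --> y.

End Webs.

End TopologicalModules.

(* Main.v *)
From HB Require Import structures.
Require Import Defs.
From mathcomp Require Import all_boot all_order all_algebra.
From mathcomp Require Import complex lra ring generic_quotient ring_quotient.
From mathcomp Require Import all_classical all_reals all_analysis.

(** The web consists of polars. Fix on each step G_p a countable base (V p n)_n
of neighborhoods of 0, which exists by metrizability, and let C(n_1, ..., n_k)
be the set of the functionals that are at most 1 on V p n_p for every p <= k.
A continuous functional is at most 1 on some V p n for every p, so this is a web
(polar_web_rcons). Polars are absolutely convex since the norm of the
generalized numbers is ultrametric (polar_absolutely_convex), and strongly
closed since points are bounded sets (polar_closed).

For type C, take rho_k = k and let x_k lie in C(n_1, ..., n_k). On G_p all x_k
with k >= p are at most 1 on V p n_p and the others are finitely many continuous
functionals, so the sequence (x_k) is equicontinuous on every step. By the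
universal property of the inductive limit, applied to the topology of the single
seminorm sup_k |x_k u|, it is equicontinuous on G
(inductive_limit_equicontinuous). So it is uniformly bounded on each bounded set
B of G, without any description of B in terms of the steps, and the k-th term of
the series is at most M exp(-k) on B. Since the generalized numbers are complete
(Ctilde_geometric_series), the series converges uniformly on bounded sets, and
its sum is continuous because it is bounded on the same neighborhood of 0 as the
x_k (equicontinuous_series_cvg). *)

Set Implicit Arguments.
Unset Strict Implicit.
Unset Printing Implicit Defensive.

Import Order.TTheory GRing.Theory Num.Theory.
Import numFieldNormedType.Exports.
Import ComplexField.Normc.

Local Open Scope classical_set_scope.
Local Open Scope ring_scope.
Local Open Scope quotient_scope.

(** * Geometric series of generalized numbers *)

Section Completeness.
Context (R : realType).

Lemma normc_sum (I : Type) (r : seq I) (P : pred I) (f : I -> R[i]) :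
  normc (\sum_(i <- r | P i) f i) <= \sum_(i <- r | P i) normc (f i).
Proof.
elim/big_ind2: _ => [|x a y b xa yb|//]; first by rewrite normc0.
exact: le_trans (normcD _ _) (lerD xa yb).
Qed.

Lemma sum_half_pow_le2 (m n : nat) :
  \sum_(m <= k < n) (2^-1 : R) ^+ k <= 2.
Proof.
apply: (@le_trans _ _ (\sum_(0 <= k < n) (2^-1 : R) ^+ k)).
  have [mn|/ltnW nm] := leqP m n; last first.
    by rewrite big_geq// sumr_ge0// => i _; rewrite exprn_ge0.
  rewrite [X in _ <= X](big_cat_nat (leq0n m) mn)/=.
  by rewrite lerDr sumr_ge0// => i _; rewrite exprn_ge0.
suff -> : \sum_(0 <= k < n) (2^-1 : R) ^+ k = 2 - 2 * 2^-1 ^+ n.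
  by rewrite gerBl mulr_ge0// exprn_ge0.
elim: n => [|n IH]; first by rewrite big_geq// expr0; lra.
by rewrite big_nat_recr//= IH exprS; lra.
Qed.

(** The constant hidden in O(eps^b) can be traded for any d > 0 at the price of
one power of eps, since K * eps <= d once eps <= d / K. *)
Lemma bigO_eps_small_const (u : net R) (b d : R) :
  0 < d -> bigO_eps u b ->
  exists eta : R, [/\ 0 < eta, eta <= d &
    forall e : eps_index R, val e < eta -> normc (u e) <= d * val e `^ (b - 1)].
Proof.
move=> d0 [K [eta [eta0 H]]].
have K1 : 0 < `|K| + 1 by rewrite ltr_wpDl.
exists (Num.min eta (d / (`|K| + 1))); split.
- by rewrite lt_min eta0 divr_gt0.
- rewrite ge_min; apply/orP; right; rewrite ler_pdivrMr//.
  by rewrite ler_peMr ?(ltW d0)// lerDr.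
move=> e; rewrite lt_min => /andP[/H + /ltW]; rewrite ler_pdivlMr// => h he.
apply: le_trans h _.
have -> : val e `^ b = val e * val e `^ (b - 1).
  rewrite -[X in X * _](powRr1 (ltW (eps_gt0 e))) -powRD ?subrKC//.
  by rewrite (gt_eqF (eps_gt0 e)) implybT.
rewrite mulrA ler_wpM2r ?powR_ge0//; apply: le_trans he.
rewrite mulrC ler_wpM2l ?(ltW (eps_gt0 e))//.
by apply: le_trans (ler_norm K) _; rewrite lerDl.
Qed.

(** A diagonal construction. By the previous lemma there are thresholds
eta k <= 2^-k below which |u k| <= 2^-k eps^(b k - 1); the net w adds up at eps
only those terms with eps < eta k. This is a finite sum because eta k tends to
0, w agrees with the first N terms for eps small enough, and the geometric
factors make the rest O(eps^(B - 1)). *)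
Lemma net_series_sum (u : nat -> net R) (b : nat -> R) :
  (forall k, bigO_eps (u k) (b k)) ->
  exists w : net R, forall N B, (forall k, (N <= k)%N -> B <= b k) ->
    bigO_eps (w - \sum_(0 <= k < N) u k) (B - 1).
Proof.
move=> Ou; have half0 k : 0 < (2^-1 : R) ^+ k by rewrite exprn_gt0.
have /choice[eta Heta] k := bigO_eps_small_const (half0 k) (Ou k).
pose g (e : eps_index R) k := if val e < eta k then u k e else 0.
(* eta k <= 2^-k <= 1/k <= e as soon as k >= 1/e *)
pose m (e : eps_index R) := Num.bound (val e)^-1.
have g0 e k : (m e <= k)%N -> g e k = 0.
  move=> mk; rewrite /g ltNge; case: (Heta k) => _ etak _.
  suff -> : eta k <= val e by [].
  apply: le_trans etak _; rewrite exprVn invf_ple ?posrE ?exprn_gt0 ?eps_gt0//.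
  apply: (@le_trans _ _ (m e)%:R).
    by apply/ltW/archi_boundP; rewrite invr_ge0 ltW ?eps_gt0.
  by rewrite -natrX ler_nat (leq_trans mk)// ltnW// ltn_expl.
pose w : net R := fun e => \sum_(0 <= k < m e) g e k.
exists w => N B HB.
have [eta' [eta'0 eta'1 Heta']] : exists eta' : R,
    [/\ 0 < eta', eta' <= 1 & forall k, (k < N)%N -> eta' <= eta k].
  elim: N {HB} => [|N [x [x0 x1 xN]]]; first by exists 1.
  exists (Num.min x (eta N)); split.
  - by rewrite lt_min x0; case: (Heta N).
  - by rewrite ge_min x1.
  - move=> k; rewrite ltnS leq_eqVlt => /predU1P[->|/xN kx].
      by rewrite ge_min lexx orbT.
    by rewrite ge_min kx.
exists 2, eta'; split=> // e ee.
have -> : (w - \sum_(0 <= k < N) u k) e = \sum_(N <= k < N + m e) g e k.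
  have -> : (w - \sum_(0 <= k < N) u k) e = w e - \sum_(0 <= k < N) u k e.
    by rewrite -[LHS]/(w e - (\sum_(0 <= k < N) u k) e) fct_sumE.
  have -> : w e = \sum_(0 <= k < N + m e) g e k.
    rewrite (@big_cat_nat _ _ _ (m e)) ?leq_addl//=.
    rewrite [X in _ + X]big_nat_cond [X in _ + X]big1 ?addr0// => k.
    by rewrite andbT => /andP[/g0].
  rewrite (@big_cat_nat _ _ _ N 0%N) ?leq_addr//=.
  suff -> : \sum_(0 <= k < N) g e k = \sum_(0 <= k < N) u k e.
    by rewrite addrAC subrr add0r.
  rewrite !big_mkord; apply: eq_bigr => k _.
  by rewrite /g (lt_le_trans ee (Heta' k (ltn_ord k))).
apply: le_trans (normc_sum _ _ _) _.
apply: (@le_trans _ _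
  (\sum_(N <= k < N + m e) 2^-1 ^+ k * val e `^ (B - 1))); last first.
  by rewrite -mulr_suml ler_wpM2r ?powR_ge0// sum_half_pow_le2.
apply: ler_sum_nat => k /andP[Nk _]; rewrite /g; case: ifPn => [ek|_].
  case: (Heta k) => _ _ /(_ e ek) /le_trans; apply.
  rewrite ler_wpM2l ?(ltW (half0 k))// ger_powR ?eps_gt0 ?eps_le1//.
  by rewrite lerB// HB.
by rewrite normc0 mulr_ge0 ?powR_ge0// ltW.
Qed.

Lemma bigO_repr0 (b : R) : bigO_eps (val (repr (0 : Ctilde R))) b.
Proof.
have -> : (0 : Ctilde R) = \pi_(Ctilde R) (0 : Defs.EM R) by rewrite pi_zeror.
by rewrite bigO_eps_repr rmorph0; exact: bigO_eps0.
Qed.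

Lemma bigO_repr_sum (c : nat -> Ctilde R) (m n : nat) (b : R) :
  (forall k, (m <= k < n)%N -> bigO_eps (val (repr (c k))) b) ->
  bigO_eps (val (repr (\sum_(m <= k < n) c k))) b.
Proof.
move=> H; rewrite big_nat_cond; elim/big_ind: _ => [|x y Ox Oy|k].
- exact: bigO_repr0.
- exact: bigO_reprD.
- by rewrite andbT => /H.
Qed.

(** The lower bound on b makes the sum of the representatives moderate. *)
Lemma Ctilde_series_sum (c : nat -> Ctilde R) (b : nat -> R) :
  (forall k, bigO_eps (val (repr (c k))) (b k)) ->
  (exists B, forall k, B <= b k) ->
  exists s : Ctilde R, forall N B, (forall k, (N <= k)%N -> B <= b k) ->
    bigO_eps (val (repr (s - \sum_(0 <= k < N) c k))) (B - 1).
Proof.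
move=> Oc [B0 HB0]; have [w Hw] := net_series_sum Oc.
have Mw : w \in @moderate R.
  apply: (@bigO_moderate _ _ (B0 - 1)).
  by have := Hw 0%N B0 (fun k _ => HB0 k); rewrite big_geq// subr0.
exists (\pi_(Ctilde R) (exist _ w Mw : Defs.EM R)) => N B /Hw.
have -> : \pi_(Ctilde R) (exist _ w Mw : Defs.EM R) - \sum_(0 <= k < N) c k =
    \pi_(Ctilde R) ((exist _ w Mw : Defs.EM R) - \sum_(0 <= k < N) repr (c k)).
  rewrite rmorphB rmorph_sum; congr (_ - _).
  by apply: eq_bigr => k _; exact: (esym (reprK (c k))).
by rewrite bigO_eps_repr rmorphB rmorph_sum.
Qed.

(** The part of the completeness of the generalized numbers that series of type
C call for. One sum s serves every admissible M, so that estimates of the terms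
that are uniform in a parameter pass to the sums. Nothing is lost in the
constant: the sums of the nets lose some powers of eps, but far out in the
series this is harmless, and the ultrametric inequality carries the estimate
back to the N-th remainder. *)
Lemma Ctilde_geometric_series (c : nat -> Ctilde R) :
  (exists2 M : R, 0 < M & forall k, enorm (c k) <= M * expR (- k%:R)) ->
  exists s : Ctilde R, forall M : R, 0 < M ->
    (forall k, enorm (c k) <= M * expR (- k%:R)) ->
    forall N, enorm (s - \sum_(0 <= k < N) c k) <= M * expR (- N%:R).
Proof.
have geoP (M : R) (k : nat) (x : Ctilde R) : 0 < M ->
    enorm x <= M * expR (- k%:R) <->
    forall b : R, b < k%:R - ln M -> bigO_eps (val (repr x)) b.
  move=> M0; rewrite enorm_leP ?mulr_gt0 ?expR_gt0//.
  by rewrite lnM ?posrE ?expR_gt0// expRK opprD opprK addrC.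
move=> [M0 M00 Hc].
have [||s Hs] := @Ctilde_series_sum c (fun k => k%:R - ln M0 - 1).
  - by move=> k; apply: (iffLR (geoP _ _ _ M00) (Hc k)); rewrite ltrBlDr ltrDl.
  by exists (0 - ln M0 - 1) => k; rewrite !lerB.
exists s => M M1 HM N; apply/geoP => // b bN.
(* far enough for the exponent N' - ln M0 - 2 to exceed b *)
pose N' := (N + Num.bound `|b + ln M0 + 2|%R)%N.
have -> : s - \sum_(0 <= k < N) c k =
    s - \sum_(0 <= k < N') c k + \sum_(N <= k < N') c k.
  rewrite (@big_cat_nat _ _ _ N 0%N N') ?leq_addr//=.
  by rewrite opprD addrA subrK.
apply: bigO_reprD.
  apply: bigO_eps_le (Hs N' (N'%:R - ln M0 - 1) _).
    have : `|b + ln M0 + 2| <= N'%:R.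
      apply: le_trans (ltW (archi_boundP (normr_ge0 _))) _.
      by rewrite ler_nat leq_addl.
    by move/(le_trans (ler_norm _)); lra.
  by move=> k Nk; rewrite !lerB// ler_nat.
apply: bigO_repr_sum => k /andP[Nk _].
apply: (iffLR (geoP _ _ _ M1) (HM k)); apply: lt_le_trans bN _.
by rewrite lerB// ler_nat.
Qed.

Lemma geometric_le (M r : R) : 0 < M -> 0 < r ->
  \forall n \near \oo, M * expR (- n%:R) <= r.
Proof.
move=> M0 r0; exists (Num.bound `|ln M - ln r|) => // n /= hn.
rewrite -[M]lnK ?posrE// -expRD -[leRHS]lnK ?posrE// ler_expR.
have := archi_boundP (normr_ge0 (ln M - ln r)).
have := ler_norm (ln M - ln r).
by move: hn; rewrite -(ler_nat R); lra.
Qed.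

Lemma enorm_geometric_eq0 (c : Ctilde R) (M : R) : 0 < M ->
  (forall n, enorm c <= M * expR (- n%:R)) -> c = 0.
Proof.
move=> M0 H; apply/enorm_eq0/eqP; rewrite eq_le enorm_ge0 andbT.
apply/ler_addgt0Pr => r r0; rewrite add0r.
have [n _ /(_ n (leqnn n))] := geometric_le M0 r0.
exact: le_trans (H n).
Qed.

End Completeness.

(** * Linear topologies and functionals on inductive limits *)

Section LinearTopologies.
Context (R : realType).

Lemma eps_powNK (a : R) : eps_pow a * eps_pow (- a) = 1 :> Ctilde R.
Proof.
have -> : (1 : Ctilde R) = \pi_(Ctilde R) (1 : Defs.EM R) by rewrite pi_oner.
rewrite /eps_pow -pi_mulr; congr (\pi_(Ctilde R) _).
apply/val_inj/funext => e; rewrite rmorphM rmorph1/= mulrfctE -rmorphM/=.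
rewrite -powRD ?subrr ?powRr0//.
by rewrite (gt_eqF (eps_gt0 e)) implybT.
Qed.

Lemma enorm_eps_powM (b : R) (c : Ctilde R) (r : R) : 0 < r ->
  enorm c <= r -> enorm (eps_pow b * c) <= r * expR (- b).
Proof.
move=> r0 cr; rewrite [r * _]mulrC.
by apply: enorm_mul cr; rewrite ?expR_gt0//; exact: enorm_eps_pow.
Qed.

Variables (V : lmodType (Ctilde R)) (t : topology V).
Hypothesis tL : linear_topology t.

Lemma near_scale (a : Ctilde R) (U : set V) :
  nbhs (0 : topologized t) U ->
  \forall x \near (0 : topologized t), U (a *: (x : V)).
Proof.
move=> U0; have U0' : nbhs (a *: (0 : topologized t)) U by rewrite scaler0.
have := tL.2 (a, 0) _ U0'.
exact: (cvg_pair (cvg_cst a) (@cvg_id _ (nbhs (0 : topologized t)))).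
Qed.

Lemma near_translate (x : V) (U : set V) :
  nbhs (0 : topologized t) U ->
  \forall y \near (x : topologized t), U ((y : V) - x).
Proof.
move=> U0; have U0' : nbhs ((x : topologized t) - x) U by rewrite subrr.
have := tL.1 (x, - x) _ U0'.
exact: (cvg_pair (@cvg_id _ (nbhs (x : topologized t)))
  (cvg_cst (- x : topologized t))).
Qed.

(** Singletons are absorbed because c *: u tends to 0 with c, and eps_pow (- b)
tends to 0 as b goes to -oo. *)
Lemma bounded_set1 (u : V) : bounded t [set u].
Proof.
move=> U U0; have U0' : nbhs (0 *: (u : topologized t)) U by rewrite scale0r.
have : \forall c \near (0 : Ctilde R), U (c *: u).
  have := tL.2 (0, u) _ U0'.
  exact: (cvg_pair (@cvg_id _ (nbhs (0 : Ctilde R)))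
    (cvg_cst (u : topologized t))).
move=> /nbhs_ballP[r /= r0 rU].
exists (ln r - 1) => b ba _ ->; exists (eps_pow (- b) *: u).
  apply: rU; rewrite ballEmdist /= -[mdist _ _]/(Defs.edist _ _) edistC.
  rewrite /Defs.edist subr0.
  apply: le_lt_trans (enorm_eps_pow _) _; rewrite opprK -[ltRHS]lnK ?posrE//.
  by rewrite ltr_expR (le_lt_trans ba)// ltrBlDr ltrDl.
by rewrite scalerA eps_powNK scale1r.
Qed.

Lemma linear_near0_continuous (f : {linear V -> (Ctilde R)^o}) :
  (\forall u \near (0 : topologized t), enorm (f u) <= 1) ->
  continuous (f : topologized t -> Ctilde R).
Proof.
move=> f1 x; apply/enorm_cvgP => r r0; pose a : R := 1 - ln r.
have := near_translate x (near_scale (eps_pow (- a)) f1).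
apply: filterS => y hy.
have -> : f y - f x = eps_pow a * f (eps_pow (- a) *: ((y : V) - x)).
  by rewrite linearZ/= mulrA eps_powNK mul1r linearB.
apply: le_lt_trans (enorm_eps_powM a ltr01 hy) _.
rewrite mul1r -[ltRHS]lnK ?posrE// ltr_expR /a; lra.
Qed.

End LinearTopologies.

Section Metrizable.
Context (R : realType).

Lemma metrizable_countable_base (T : choiceType) (t : topology T) (x : T) :
  metrizable R t ->
  exists U : nat -> set T, (forall n, nbhs (x : topologized t) (U n)) /\
    forall A, nbhs (x : topologized t) A -> exists n, U n `<=` A.
Proof.
move=> [d [_ _ _ _ dP]].
exists (fun n => [set y | d x y < n.+1%:R^-1]); split=> [n|A /dP[r r0 rA]].
  by apply/dP; exists n.+1%:R^-1 => //; rewrite invr_gt0.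
exists (Num.bound r^-1) => y yr; apply: rA; apply: lt_le_trans yr _.
rewrite invf_ple ?posrE//; apply/ltW/(lt_trans (archi_boundP _)).
  by rewrite invr_ge0 ltW.
by rewrite ltr_nat.
Qed.

End Metrizable.

Section Equicontinuity.
Context (R : realType) (G : lmodType (Ctilde R)) (Gs : nat -> submodClosed G).
Variables (ts : forall p : nat, topology (submod_of (Gs p))) (t : topology G).
Hypothesis tG : strict_inductive_limit ts t.

(** The universal property of the inductive limit for families of functionals:
equicontinuity on every step gives equicontinuity on the limit. The seminorm
P u = sup_i |f i u| is finite, as u lies in some step and singletons are
bounded there, and it is continuous on every step. So the topology of P alone is
locally convex and makes the inclusions continuous; the inductive limit topology
is finer, and the unit ball of P is one of its neighborhoods of 0. *)
Lemma inductive_limit_equicontinuous (J : Type)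
    (f : J -> {linear G -> (Ctilde R)^o}) :
  (forall p, \forall x \near (0 : topologized (ts p)),
     forall i, enorm (f i (val x)) <= 1) ->
  \forall u \near (0 : topologized t), forall i, enorm (f i u) <= 1.
Proof.
move=> fp.
have fZ i a x : f i (a *: x) = a * f i x by rewrite linearZ.
have fvZ p i a (x : submod_of (Gs p)) : f i (val (a *: x)) = a * f i (val x).
  exact: fZ.
(* a family of seminorms with a single index *)
pose P (_ : unit) u : \bar R := ereal_sup [set (enorm (f i u))%:E | i in setT].
have PP j u r : (P j u <= r%:E)%E <-> forall i, enorm (f i u) <= r.
  split=> [h i|h].
    rewrite -lee_fin; apply: le_trans h.
    by apply: ereal_sup_ubound; exists i.
  by apply: ge_ereal_sup => _ [i _ <-]; rewrite lee_fin.
have PD j x y (r : R) : 0 < r ->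
    (P j x <= r%:E)%E -> (P j y <= r%:E)%E -> (P j (x + y)%R <= r%:E)%E.
  move=> r0 /PP hx /PP hy; apply/PP => i; rewrite linearD.
  exact: enorm_ultra.
have PZ j a x (r s : R) : 0 < r -> 0 < s ->
    enorm a <= r -> (P j x <= s%:E)%E -> (P j (a *: x)%R <= (r * s)%:E)%E.
  move=> r0 s0 ar /PP hx; apply/PP => i; rewrite fZ.
  exact: enorm_mul.
have Pfin j x : [set: unit] j -> exists2 s : R, 0 < s & (P j x <= s%:E)%E.
  move=> _; have [p xp] := sil_exhausting tG x.
  pose x' : submod_of (Gs p) := exist _ x xp.
  have [a /(_ a (lexx a) x' erefl)[y y1 yx]] :=
    bounded_set1 (sil_locally_convex_steps tG p).1 x' (fp p).
  exists (1 * expR (- a)); first by rewrite mul1r expR_gt0.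
  apply/PP => i; have -> : x = val x' by [].
  by rewrite -yx fvZ; apply: enorm_eps_powM.
have lcP := seminorm_topology_locally_convex PD PZ Pfin.
have cP : continuous_inclusions ts (seminorm_topology setT P).
  move=> p; have tsL := (sil_locally_convex_steps tG p).1.
  move=> x; apply: (seminorm_cvgP PD PZ Pfin) => j r _ r0.
  pose a : R := - ln r.
  have := near_translate tsL x (near_scale tsL (eps_pow (- a)) (fp p)).
  apply: filterS => y hy; apply/PP => i.
  have -> : val y - val x =
      val (eps_pow a *: (eps_pow (- a) *: ((y : submod_of (Gs p)) - x))).
    by rewrite scalerA eps_powNK scale1r raddfB.
  rewrite fvZ -[r]lnK ?posrE// -[ln r]opprK -[leRHS]mul1r.
  exact: enorm_eps_powM ltr01 (hy i).
have : nbhs (0 : topologized (seminorm_topology setT P))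
    [set u | forall i, enorm (f i u) <= 1].
  have := near_seminorm PD PZ Pfin (0 : topologized (seminorm_topology setT P))
    (I : setT tt) ltr01.
  by apply: filterS => u /PP; rewrite subr0.
rewrite !nbhsE; move=> [W [oW W0] Wf].
by exists W => //; split=> //; exact: (sil_finest tG lcP cP oW).
Qed.

End Equicontinuity.

(** * Polars and series in the strong dual *)

Section Dual.
Context (R : realType) (G : lmodType (Ctilde R)) (t : topology G).
Implicit Types (T : dual t) (A : set G).

Lemma dual_linear T : linear (val T).
Proof. by have /dual_predP[] := valP T. Qed.

Lemma dual_continuous T :
  continuous (val T : topologized t -> Ctilde R).
Proof. by have /dual_predP[] := valP T. Qed.

Lemma dual_zeroE u : val (0 : dual t) u = 0.
Proof. by rewrite raddf0. Qed.

Lemma dual_sumE (J : Type) (r : seq J) (f : J -> dual t) u :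
  val (\sum_(j <- r) f j) u = \sum_(j <- r) val (f j) u.
Proof.
exact: (big_morph (fun T : dual t => val T u) (fun S T => dual_addE S T u)
  (dual_zeroE u)).
Qed.

Definition linear_of_dual T : {linear G -> (Ctilde R)^o} :=
  HB.pack (val T) (GRing.isLinear.Build _ _ _ _ (val T) (dual_linear T)).

Lemma dual_linearZ T (a : Ctilde R) u : val T (a *: u) = a * val T u.
Proof. exact: (linearZZ (linear_of_dual T)). Qed.

Definition polar A : set (dual t) :=
  [set T | forall u, A u -> enorm (val T u) <= 1].

Lemma polar_absolutely_convex A : absolutely_convex (polar A).
Proof.
have polarZ (l : Ctilde R) T : enorm l <= 1 -> polar A T -> polar A (l *: T).
  move=> l1 AT u Au; rewrite dual_scaleE -[leRHS]mulr1.
  exact: enorm_mul l1 (AT u Au).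
split; first exact: polarZ.
split=> [S T AS AT u Au|b T b0].
  by rewrite dual_addE; apply: enorm_ultra ltr01 _ _; [exact: AS|exact: AT].
apply: polarZ; apply: le_trans (enorm_eps_pow b) _.
by rewrite -expR0 ler_expR oppr_le0.
Qed.

Lemma strong_openP (W : set (dual t)) :
  open (W : set (topologized (strong_topology t))) <->
  forall S, W S -> exists (F : set (set G)) (r : R),
    [/\ finite_set F, F `<=` bounded t, 0 < r &
        [set T | forall B, F B -> (sup_seminorm B (T - S)%R < r%:E)%E] `<=` W].
Proof. by []. Qed.

(** A functional S outside the polar exceeds 1 at some u in A; by the
ultrametric inequality so do all T with |T u - S u| <= 1, and these form a
strong neighborhood of S because the singleton of u is bounded. *)
Lemma polar_closed A : linear_topology t ->
  closed (polar A : set (topologized (strong_topology t))).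
Proof.
move=> tL; rewrite -openC; apply/strong_openP => S /= nS.
have [u [Au Su]] : exists u, A u /\ ~ (enorm (val S u) <= 1).
  by apply: contrapT => h; apply: nS => u Au; apply: contrapT => Su; apply: h;
    exists u.
exists [set [set u]], 1; split=> //.
  by move=> _ ->; exact: bounded_set1.
move=> T /(_ [set u] erefl) /ltW /sup_seminormP/(_ u erefl) TS AT; apply: Su.
rewrite -[S](subKr T) -[T - (T - S)]/(T + - (T - S)) dual_addE.
apply: enorm_ultra ltr01 (AT u Au) _.
by rewrite raddfN enormN.
Qed.

Lemma strong_cvgP (x : nat -> dual t) T :
  (forall B (r : R), bounded t B -> 0 < r ->
     \forall n \near \oo, (sup_seminorm B (x n - T)%R <= r%:E)%E) ->
  (x : nat -> topologized (strong_topology t)) @ \oo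
    --> (T : topologized (strong_topology t)).
Proof.
move=> h V; rewrite nbhsE; move=> [W [oW WT] WV].
have [F [r [Ff FD r0 FW]]] := iffLR (strong_openP W) oW T WT.
have r20 : 0 < r / 2 by rewrite divr_gt0.
have : \forall n \near \oo, forall B, F B ->
    (sup_seminorm B (x n - T)%R <= (r / 2)%:E)%E.
  case/finite_fsetP: Ff FD {FW} => F' -> FD.
  have := @filter_bigI _ _ F'
    (fun B => [set n | (sup_seminorm B (x n - T)%R <= (r / 2)%:E)%E]) \oo _ _.
  by apply=> B BF; apply: h => //; exact: FD.
apply: filterS => n hn; apply/WV/FW => B /hn /le_lt_trans; apply.
by rewrite lte_fin ltr_pdivrMr// ltr_pMr// ltr1n.
Qed.

(** A bounded set B lies in a multiple of the neighborhood of 0 on which all x k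
are at most 1, so the x k are at most some M on B, and the k-th term of the
series is at most M * exp (- k) there. Completeness provides the pointwise sum
T, and the same estimate bounds the remainders uniformly on B. It also bounds T
by 1 on that neighborhood, whence the continuity of T. *)
Lemma equicontinuous_series_cvg (x : nat -> dual t) (l : nat -> R) :
  linear_topology t ->
  (\forall u \near (0 : topologized t), forall k, enorm (val (x k) u) <= 1) ->
  (forall k, k%:R <= l k) ->
  exists T : topologized (strong_topology t),
    (series (fun k => eps_pow (l k) *: x k) :
       nat -> topologized (strong_topology t)) @ \oo --> T.
Proof.
move=> tL x1 hl; pose c u k : Ctilde R := eps_pow (l k) * val (x k) u.
have xB B : bounded t B -> exists2 M : R, 0 < M &
    forall u, B u -> forall k, enorm (c u k) <= M * expR (- k%:R).
  move=> /(_ _ x1)[a /(_ a (lexx a)) aB].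
  exists (expR (- a)); first exact: expR_gt0.
  move=> _ /aB[u u1 <-] k.
  rewrite /c dual_linearZ.
  apply: le_trans (enorm_eps_powM (l k) (expR_gt0 (- a)) _) _.
    by rewrite -[leRHS]mul1r; apply: enorm_eps_powM ltr01 (u1 k).
  by rewrite ler_wpM2l ?expR_ge0// ler_expR lerN2.
have xu u : exists2 M : R, 0 < M & forall k, enorm (c u k) <= M * expR (- k%:R).
  by have [M M0 /(_ u erefl) HM] := xB _ (bounded_set1 tL u); exists M.
have /choice[T HT] u := Ctilde_geometric_series (xu u).
(* the defect of linearity is at most M * exp (- n) for every n *)
have lT : linear (T : G -> (Ctilde R)^o).
  move=> a u v; apply/eqP; rewrite -subr_eq0; apply/eqP.
  have [M1 M10 HM1] := xu (a *: u + v).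
  have [M2 M20 HM2] := xu u.
  have [M3 M30 HM3] := xu v.
  have a0 : 0 < enorm a + 1 by rewrite ltr_wpDl ?enorm_ge0.
  have M0 : 0 < M1 + (enorm a + 1) * M2 + M3 by rewrite !addr_gt0 ?mulr_gt0.
  apply: (enorm_geometric_eq0 M0) => n.
  have cl : \sum_(0 <= k < n) c (a *: u + v) k =
      a * \sum_(0 <= k < n) c u k + \sum_(0 <= k < n) c v k.
    rewrite mulr_sumr -big_split/=; apply: eq_bigr => k _.
    by rewrite /c dual_linear mulrDr mulrCA.
  have -> : T (a *: u + v) - (a *: (T u : (Ctilde R)^o) + T v) =
      (T (a *: u + v) - \sum_(0 <= k < n) c (a *: u + v) k)
      - (a * (T u - \sum_(0 <= k < n) c u k)
      + (T v - \sum_(0 <= k < n) c v k)).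
    rewrite cl -[a *: (T u : (Ctilde R)^o)]/(a * T u); ring.
  have e0 := expR_gt0 (- n%:R : R).
  have M0e : 0 < (M1 + (enorm a + 1) * M2 + M3) * expR (- n%:R).
    by rewrite mulr_gt0.
  have m2 : 0 < (enorm a + 1) * M2 by rewrite mulr_gt0.
  apply: enorm_ultra => //.
    apply: le_trans (HT _ _ M10 HM1 n) _; rewrite ler_pM2r//; lra.
  rewrite enormN; apply: enorm_ultra => //.
    have := enorm_mul a0 (mulr_gt0 M20 e0) _ (HT _ _ M20 HM2 n) => /(_ a).
    rewrite lerDl ler01 mulrA => /(_ isT) /le_trans; apply.
    rewrite ler_pM2r//; lra.
  apply: le_trans (HT _ _ M30 HM3 n) _; rewrite ler_pM2r//; lra.
have cT : continuous (T : topologized t -> Ctilde R).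
  pose F : {linear G -> (Ctilde R)^o} :=
    HB.pack (T : G -> (Ctilde R)^o) (GRing.isLinear.Build _ _ _ _ T lT).
  apply: (linear_near0_continuous tL (f := F)).
  apply: filterS x1 => u u1 /=.
  have cu k : enorm (c u k) <= 1 * expR (- k%:R).
    apply: le_trans (enorm_eps_powM (l k) ltr01 (u1 k)) _.
    by rewrite !mul1r ler_expR lerN2.
  by have := HT u 1 ltr01 cu 0%N; rewrite big_geq// subr0 oppr0 expR0 mulr1.
have TD : (T : G -> (Ctilde R)^o) \in dual_pred t by apply/dual_predP.
pose T' : dual t :=
  exist (fun f => f \in dual_pred t) (T : G -> (Ctilde R)^o) TD.
exists T'; apply: strong_cvgP => B r /xB[M M0 HM] r0.
have Hn n : (sup_seminorm B
    (series (fun k => eps_pow (l k) *: x k) n - T')%R <=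
    (M * expR (- n%:R))%:E)%E.
  apply/sup_seminormP => u Bu.
  have -> : val (series (fun k => eps_pow (l k) *: x k) n - T') u =
      - (T u - \sum_(0 <= k < n) c u k).
    rewrite dual_addE opprB raddfN; congr (_ + _).
    rewrite /series/= dual_sumE; apply: eq_bigr => k _.
    exact: dual_scaleE.
  by rewrite enormN; apply: HT => //; exact: HM.
apply: filterS (geometric_le M0 r0) => n Mn.
by apply: le_trans (Hn n) _; rewrite lee_fin.
Qed.
End Dual.

(** * The web of polars *)

Section PolarWeb.
Context (R : realType) (G : lmodType (Ctilde R)) (t : topology G).
Variable V : nat -> nat -> set G.

(** The polar of a union is an intersection of polars, so this is the set of the
functionals that are at most 1 on each V p s_p. *)
Definition polar_web (s : seq nat) : set (dual t) :=
  polar (\bigcup_(p in `I_(size s)) V p (nth 0%N s p)).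

Lemma polar_web_rcons (s : seq nat) :
  (forall T : dual t, exists n,
     V (size s) n `<=` [set u | enorm (val T u) <= 1]) ->
  polar_web s = \bigcup_n polar_web (rcons s n).
Proof.
move=> hV; apply/seteqP; split=> T.
  move=> Ts; have [n hn] := hV T; exists n => // u [p /=].
  rewrite size_rcons nth_rcons ltnS leq_eqVlt => /predU1P[->|ps].
    by rewrite ltnn eqxx => /hn.
  by rewrite ps => Vu; apply: Ts; exists p.
move=> [n _ Tn] u [p /= ps Vu]; apply: Tn; exists p => /=.
  by rewrite size_rcons ltnW.
by rewrite nth_rcons ps.
Qed.

End PolarWeb.

Arguments polar_web {R G} t V.

Theorem theorem1p17 (R : realType) (G : lmodType (Ctilde R))
    (Gs : nat -> submodClosed G)
    (ts : forall p : nat, topology (submod_of (Gs p)))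
    (t : topology G) :
  strict_inductive_limit ts t ->
  (forall p : nat, metrizable R (ts p)) ->
  exists W : seq nat -> set (dual t),
    [/\ is_web W,
        absolutely_convex_web W,
        closed_web (strong_topology t) W &
        web_of_type_C (strong_topology t) W].
Proof.
move=> tG mG.
have tL : linear_topology t := (sil_locally_convex tG).1.
have near_dual (T : dual t) p :
    \forall x \near (0 : topologized (ts p)), enorm (val T (val x)) <= 1.
  have T0 : val T 0 = 0 by exact: (linear0 (linear_of_dual T)).
  have /enorm_cvgP/(_ 1 ltr01) := @dual_continuous _ _ _ T 0.
  rewrite T0 => T1.
  have : nbhs (val (0 : submod_of (Gs p)) : topologized t)
      [set u | enorm (val T u) <= 1].
    by rewrite raddf0; apply: filterS T1 => u; rewrite subr0 => /ltW.
  exact: (sil_continuous tG).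
(* bases of the steps, pushed to G so that they share a type *)
have base p : exists V : nat -> set G,
    (forall n, \forall x \near (0 : topologized (ts p)), V n (val x)) /\
    forall A : set G, (\forall x \near (0 : topologized (ts p)), A (val x)) ->
      exists n, V n `<=` A.
  have [U [U0 UA]] := metrizable_countable_base (0 : submod_of (Gs p)) (mG p).
  exists (fun n => val @` U n); split=> [n|A /UA[n nA]].
    by apply: filterS (U0 n) => x Ux; exists x.
  by exists n => _ [x /nA Ax <-].
have /choice[V HV] := base.
have rconsV s : polar_web t V s = \bigcup_n polar_web t V (rcons s n).
  apply: polar_web_rcons => T; have [_] := HV (size s); apply.
  exact: near_dual.
exists (polar_web t V); split.
- split=> [|s _]; last exact: rconsV.
  rewrite -(rconsV [::]); by apply/seteqP; split=> // T _ u [p].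
- by move=> s _; exact: polar_absolutely_convex.
- by move=> s _; exact: polar_closed.
- (* the terms of the series get the ratio exp (- 1) *)
  move=> n; exists (fun k => k%:R) => l x kl xW.
  apply: equicontinuous_series_cvg => //.
  (* on step p, all but the first p functionals are at most 1 on V p (n p),
     and those p functionals are continuous *)
  have := inductive_limit_equicontinuous tG
    (f := fun k => linear_of_dual (x k)).
  apply=> p.
  have late : \forall y \near (0 : topologized (ts p)),
      forall k, (p <= k)%N -> enorm (val (x k) (val y)) <= 1.
    apply: filterS ((HV p).1 (n p)) => y Vy k pk; apply: (xW k).
    by exists p; [rewrite /= size_map size_iota|rewrite nth_mkseq].
  have early q : \forall y \near (0 : topologized (ts p)),
      forall k, (k < q)%N -> enorm (val (x k) (val y)) <= 1.
    elim: q => [|q IH]; first exact: filterE.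
    apply: filterS2 IH (near_dual (x q) p) => y y1 y2 k.
    by rewrite ltnS leq_eqVlt => /predU1P[->|/y1].
  apply: filterS2 (early p) late => y y1 y2 k.
  by have [/y2|/y1] := leqP p k.
Qed.
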